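(* For every function $g:\mathbb{N}\to\mathbb{N}$, there is no $\mathrm{DistLocal}[o(\log^* n)]$-algorithm that solves the $\mathrm{o\text{-}rad}(g)$-problem.
   Context: In the $\mathrm{o\text{-}rad}(g)$-problem, the input is an undirected graph $G$ with maximum degree $\Delta$ and the goal is to compute an acyclic orientation $H$ of $G$ (each edge directed one way, no directed cycles) with $\mathrm{rad}(H)\le g(\Delta)$, where $\mathrm{rad}(H)$ is the number of edges on a longest directed path in $H$. In the DistLocal model computation is on the input graph with $n$ vertices, each a processor knowing its distinct ID (polynomial in $n$), degree, $\Delta$, $n$ and ports; in synchronous rounds vertices exchange unbounded-length messages with neighbors and compute arbitrarily; at the end each vertex outputs (here) the directions of its incident edges. $\mathrm{DistLocal}[r]$ means $r$ rounds. *)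

(* Defs.v *)
From mathcomp Require Import all_boot all_order all_algebra.

Set Implicit Arguments.
Unset Strict Implicit.
Unset Printing Implicit Defensive.

(* [up_log 2 n] is the ceiling of log_2 n.  Rounding up at every step does not
   change log*: an integer bounds x iff it bounds the ceiling of x, so the
   k-fold iterate is at most 1 iff the k-fold iterate of the real log_2 is. *)
Lemma logstar_subproof (n : nat) : exists k, iter k (up_log 2) n <= 1.
Proof.
have [m] := ubnP n; elim: m n => // m IHm n lt_nm.
have [le_n1 | lt_1n] := leqP n 1; first by exists 0.
have lt_log : up_log 2 n < n.
  case: n lt_1n {lt_nm} => [|[|n]] // _.
  by rewrite ltnS up_log_min // ltn_expl.
have [k le_k1] := IHm _ (leq_trans lt_log lt_nm).
by exists k.+1; rewrite iterSr.
Qed.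

Definition logstar (n : nat) : nat := ex_minn (logstar_subproof n).

Definition little_o (f h : nat -> nat) : Prop :=
  forall eps : rat, (0 < eps)%R ->
  exists N, forall n, N <= n -> ((f n)%:R <= eps * (h n)%:R)%R.

Record sgraph (T : finType) := SGraph {
  adj : rel T;
  adj_sym : symmetric adj;
  adj_irr : irreflexive adj
}.

Definition deg (T : finType) (G : sgraph T) (v : T) : nat := #|adj G v|.

Definition maxdeg (T : finType) (G : sgraph T) : nat := \max_(v : T) deg G v.

Definition orientation (T : finType) (G : sgraph T) (H : rel T) : Prop :=
  (forall u v, H u v -> adj G u v) /\
  (forall u v, adj G u v -> H u v (+) H v u).

Definition acyclic (T : finType) (H : rel T) : Prop :=
  forall p : seq T, cycle H p -> p = [::].

(* The directed path x :: p has size p edges; since its vertices are distinct,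
   it has fewer than #|T| edges. *)
Definition rad (T : finType) (H : rel T) : nat :=
  \max_(k < #|T| | [exists x : T, exists p : k.-tuple T,
                      path H x p && uniq (x :: p)]) k.

(* Port i of v leads to the i-th element of [ports v], counting from 0. *)
Record network (T : finType) := Network {
  graph :> sgraph T;
  ports : T -> seq T;
  ports_uniq : forall v, uniq (ports v);
  mem_ports : forall v u, (u \in ports v) = adj graph v u;
  ident : T -> nat;
  ident_inj : injective ident
}.

Definition ident_bound (c : nat) (T : finType) (N : network T) : Prop :=
  forall v, 1 <= ident N v <= #|T| ^ c.

(* [init n Delta id d] is the initial state of a vertex with identifier id and
   degree d.  [send s i] is the message sent through port i.  [recv s ms] is
   the new state, where ms lists the received messages in the order of the
   ports of the receiver.  [out s i] says whether the edge at port i is output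
   as outgoing (true) or incoming (false). *)
Record algorithm := Algorithm {
  state : Type;
  msg : Type;
  init : nat -> nat -> nat -> nat -> state;
  send : state -> nat -> msg;
  recv : state -> seq msg -> state;
  out : state -> nat -> bool
}.

Section Execution.

Variables (A : algorithm) (T : finType) (N : network T).

Definition start (v : T) : state A :=
  init A #|T| (maxdeg N) (ident N v) (deg N v).

Definition round (s : T -> state A) (v : T) : state A :=
  recv (s v) [seq send (s u) (index v (ports N u)) | u <- ports N v].

Definition run (r : nat) : T -> state A := iter r round start.

(* The arcs u -> v claimed by the tail u; [orientation] then requires the
   outputs of the two ends of every edge to agree. *)
Definition output (r : nat) : rel T :=
  fun u v => adj N u v && out (run r u) (index v (ports N u)).

End Execution.

Definition solves_orad (g : nat -> nat) (c : nat) (r : nat -> nat)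
    (A : algorithm) : Prop :=
  forall (T : finType) (N : network T), ident_bound c N ->
  let H := output A N (r #|T|) in
  [/\ orientation N H, acyclic H & rad H <= g (maxdeg N)].

(* Main.v *)
Require Import Defs.
From mathcomp Require Import all_boot all_order all_algebra.
From mathcomp Require Import zify lra.
Import Num.Theory GRing.Theory.

Set Implicit Arguments.
Unset Strict Implicit.
Unset Printing Implicit Defensive.

(** Run the algorithm on a cycle whose ports are numbered consistently. After r
    rounds, the direction of an edge is a function of the 2r + 1 identifiers
    around its tail, and no g(2) + 1 consecutive edges point the same way. Hence
    the directions of L = g(2) + 1 consecutive edges form a colour, with 2 ^ L
    possible values, that differs between neighbouring windows of 2r + L
    identifiers. Restrict to increasing windows, and replace the colour of a
    window by the set of colours of its extensions by one larger identifier: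
    this shortens the window by one and exponentiates the number of colours
    (Linial's argument). Windows of length one need n colours, so n is at most a
    tower of height 2r + O(1). *)

(** * Towers of twos and log* *)

Local Notation tower k := (iter k (expn 2)).

Lemma leq_tower k a b : a <= b -> tower k a <= tower k b.
Proof. by elim: k => //= k IHk le_ab; rewrite leq_exp2l ?IHk. Qed.

Lemma tower1_ltn : {homo (fun k => tower k 1) : j k / j < k}.
Proof. by apply: homo_ltn => [k|k]; [exact: ltn_trans | exact: ltn_expl]. Qed.

Lemma ltn_tower1 k : k < tower k 1.
Proof. by elim: k => //= k IHk; apply: leq_ltn_trans IHk (ltn_expl _ _). Qed.

Lemma logstar_tower k : logstar (tower k 1) <= k.
Proof.
rewrite /logstar; case: ex_minnP => j _; apply.
by elim: k => // k IHk; rewrite iterSr /= up_expnK.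
Qed.

(** * Colour reduction on increasing windows *)

Section ShiftColouring.

Variable n : nat.

(** A proper colouring of the shift graph on increasing windows of [t.+1] numbers below [n]. As the
    windows increase, bounding the last entry is enough. *)
Definition shift_colouring (t : nat) (K : eqType) (f : seq nat -> K) : Prop :=
  forall x s y, size s = t -> sorted ltn (x :: rcons s y) -> y < n ->
  f (x :: s) != f (rcons s y).

Definition extension_colours (K : finType) (f : seq nat -> K) s : {set K} :=
  [set k | [exists z : 'I_n, (last 0 s < z) && (f (rcons s z) == k)]].

(** The colour of [x :: rcons s y] lies in the set of [x :: s], through the extension [y]. In the
    set of [rcons s y] it would be the colour of the next window, which ends in some [z > y],
    against properness. *)
Lemma extension_colouring t (K : finType) (f : seq nat -> K) :
  shift_colouring t.+1 f -> shift_colouring t (extension_colours f).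
Proof.
move=> col_f x s y sz_s srt lt_yn; apply/eqP=> /setP/(_ (f (x :: rcons s y))).
rewrite !inE; have -> : [exists z : 'I_n, (last 0 (x :: s) < z)
    && (f (rcons (x :: s) z) == f (x :: rcons s y))].
  apply/existsP; exists (Ordinal lt_yn); rewrite /= eqxx andbT.
  by move: srt; rewrite /= rcons_path => /andP[].
move/esym/existsP=> [z /andP[]]; rewrite last_rcons => lt_yz /eqP eq_f.
have := col_f x (rcons s y) z; rewrite size_rcons sz_s eq_f eqxx.
suff srt' : sorted ltn (x :: rcons (rcons s y) z) by move/(_ erefl srt' (ltn_ord z)).
by rewrite /= rcons_path last_rcons; apply/andP.
Qed.

Lemma shift_colouring_card t (K : finType) (f : seq nat -> K) :
  shift_colouring t f -> n <= tower t #|K|.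
Proof.
elim: t K f => [|t IHt] K f col_f.
  have inj_f : injective (fun i : 'I_n => f [:: val i]).
    move=> i j eq_f; apply/val_inj; apply: contra_eq eq_f => /=.
    rewrite neq_ltn => /orP[] lt_ij; last rewrite eq_sym;
      by apply: (col_f _ [::]); rewrite //= ?lt_ij.
  by rewrite -[n]card_ord; apply: leq_card inj_f.
(* The new colours are the [2 ^ #|K|] subsets of [K], which adds an exponential at the bottom of the
   tower. *)
by have := IHt _ _ (extension_colouring col_f); rewrite -cardsT -powersetT card_powerset cardsT iterSr.
Qed.

End ShiftColouring.

(** * The cycle with consistent ports and prescribed identifiers *)

Section Cycle.

Variable m : nat.
Let n := m.+3.

Definition cycle_adj : rel 'I_n := fun u v => (v == ordS u) || (u == ordS v).

Lemma cycle_adj_sym : symmetric cycle_adj.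
Proof. by move=> u v; rewrite /cycle_adj orbC. Qed.

Lemma ordS_neq (u : 'I_n) : (u == ordS u) = false.
Proof.
apply/negP=> /eqP/(congr1 val) /=.
have := ltn_ord u; rewrite /n leq_eqVlt => /orP[/eqP[->]|lt_u].
  by rewrite modnn.
by rewrite modn_small //; lia.
Qed.

(** Needs at least three vertices, hence [m.+3]; it keeps the two ports of a vertex distinct. *)
Lemma ordSS_neq (u : 'I_n) : (u == ordS (ordS u)) = false.
Proof.
apply/negP=> /eqP/(congr1 val) /=.
rewrite -addn1 modnDml addn1; have lt_u := ltn_ord u.
have [lt_u2|le_u2] := ltnP u.+2 n; first by rewrite modn_small //; lia.
have -> : u.+2 = (u.+2 - n) + n by rewrite subnK.
by rewrite modnDr modn_small /n; move: lt_u le_u2; rewrite /n; lia.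
Qed.

Lemma cycle_adj_irr : irreflexive cycle_adj.
Proof. by move=> u; rewrite /cycle_adj ordS_neq. Qed.

Definition cycle_graph := SGraph cycle_adj_sym cycle_adj_irr.

(** Port 0 leads forward and port 1 backward at every vertex, so only identifiers tell vertices
    apart. *)
Definition cycle_ports (v : 'I_n) := [:: ordS v; ord_pred v].

Lemma ordS_neq_pred (v : 'I_n) : (ordS v == ord_pred v) = false.
Proof. by rewrite -(inj_eq (@ordS_inj n)) ord_predK eq_sym ordSS_neq. Qed.

Lemma cycle_ports_uniq v : uniq (cycle_ports v).
Proof. by rewrite /= inE ordS_neq_pred. Qed.

Lemma mem_cycle_ports v u : (u \in cycle_ports v) = adj cycle_graph v u.
Proof.
by rewrite !inE /= /cycle_adj -(inj_eq (@ordS_inj n) u (ord_pred v)) ord_predK (eq_sym v).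
Qed.

Lemma cycle_deg v : deg cycle_graph v = 2.
Proof.
rewrite /deg -(eq_card (mem_cycle_ports v)).
exact/card_uniqP/cycle_ports_uniq.
Qed.

Lemma cycle_maxdeg : maxdeg cycle_graph = 2.
Proof.
apply/eqP; rewrite eqn_leq; apply/andP; split.
  by apply/bigmax_leqP=> v _; rewrite cycle_deg.
by rewrite -(cycle_deg ord0) /maxdeg (leq_bigmax (F := deg cycle_graph)).
Qed.

Variable s : seq nat.
Hypothesis s_perm : perm_eq s (iota 0 n).

Definition cycle_ident (v : 'I_n) := (nth 0 s v).+1.

Lemma cycle_ident_inj : injective cycle_ident.
Proof.
have [sz_s uniq_s] : size s = n /\ uniq s.
  by rewrite (perm_size s_perm) (perm_uniq s_perm) size_iota iota_uniq.
move=> u v [/eqP]; rewrite nth_uniq ?sz_s ?ltn_ord // => /eqP.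
exact: val_inj.
Qed.

Definition cycle_network :=
  @Network _ cycle_graph _ cycle_ports_uniq mem_cycle_ports _ cycle_ident_inj.

Lemma cycle_ident_bound c : 0 < c -> ident_bound c cycle_network.
Proof.
move=> c_gt0 v; rewrite card_ord /= /cycle_ident.
have : nth 0 s v \in iota 0 n.
  by rewrite -(perm_mem s_perm) mem_nth // (perm_size s_perm) size_iota.
rewrite mem_iota /= => lt_n; apply: leq_trans lt_n _.
by rewrite -{1}[n]expn1 leq_exp2l.
Qed.

End Cycle.

(** * Local views and the run on the cycle *)

Section Views.

Variables (A : algorithm) (n : nat).

(* The state after r rounds of the vertex at position [i + r], which the
   positions [i, ..., i + 2r] determine. *)
Fixpoint view (x : nat -> nat) (r i : nat) : state A :=
  if r is r'.+1 then
    recv (view x r' i.+1) [:: send (view x r' i.+2) 1; send (view x r' i) 0]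
  else init A n 2 (x i).+1 2.

Lemma eq_view x y r i j :
  (forall k, k <= r.*2 -> x (i + k) = y (j + k)) -> view x r i = view y r j.
Proof.
elim: r i j => [|r IHr] i j eq_xy /=.
  by have := eq_xy 0 isT; rewrite !addn0 => ->.
rewrite (IHr i.+1 j.+1) ?(IHr i.+2 j.+2) ?(IHr i j) // => k le_k.
- by apply: eq_xy; lia.
- by rewrite !addSnnS; apply: eq_xy; lia.
- by rewrite !addSnnS; apply: eq_xy; lia.
Qed.

(** Directions of the [L] edges with tails at positions [r] to [r + L - 1]; they depend only on the
    first [2r + L] entries of [w]. *)
Definition window_colour (r L : nat) (w : seq nat) : L.-tuple bool :=
  [tuple out (view (nth 0 w) r i) 0 | i < L].

End Views.

Section CycleRun.

Variables (A : algorithm) (m : nat) (s : seq nat).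
Let n := m.+3.
Hypothesis s_perm : perm_eq s (iota 0 n).
Let N := cycle_network s_perm.

(** The bound on [i + r.*2] keeps the window from wrapping around the cycle, so neighbours sit at
    adjacent positions. *)
Lemma cycle_run r i (v : 'I_n) :
  v = i + r :> nat -> i + r.*2 < n -> run A N r v = view A n (nth 0 s) r i.
Proof.
elim: r i v => [|r IHr] i v val_v lt_in.
  rewrite /run /= /start card_ord cycle_maxdeg cycle_deg /= /cycle_ident.
  by rewrite val_v addn0.
have valS : val (ordS v) = i.+2 + r.
  by rewrite /= modn_small val_v; lia.
have valP : val (ord_pred v) = i + r.
  rewrite /= val_v (_ : (i + r.+1 + n).-1 = i + r + n); last by lia.
  by rewrite modnDr modn_small; lia.
rewrite /run iterS -/(run A N r) /round /=.
rewrite (IHr i.+1 v) ?(IHr i.+2 (ordS v)) ?(IHr i (ord_pred v)) //; try lia.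
(* The successor sends to [v] through its port 1, the predecessor through its port 0. *)
congr (recv _ [:: send _ _; send _ _]).
  by rewrite eq_sym ordSS_neq ordSK eqxx.
by rewrite ord_predK eqxx.
Qed.

End CycleRun.

(** * Paths as lower bounds on the radius *)

Lemma rad_ge (T : finType) (H : rel T) (x : T) (p : seq T) :
  path H x p -> uniq (x :: p) -> size p <= Defs.rad H.
Proof.
move=> Hp Up; have lt_p : size p < #|T|.
  by rewrite -[(size p).+1]/(size (x :: p)) -(card_uniqP Up) max_card.
apply: (@leq_bigmax_cond _ _ (fun k : 'I_#|T| => val k) (Ordinal lt_p)).
apply/existsP; exists x; apply/existsP; exists (in_tuple p).
exact/andP.
Qed.

Lemma rad_ge_rev (T : finType) (H : rel T) (x : T) (p : seq T) :
  path (fun u v => H v u) x p -> uniq (x :: p) -> size p <= Defs.rad H.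
Proof.
move=> Hp Up; rewrite -(size_belast x) -size_rev.
apply: (@rad_ge _ _ (last x p)); first by rewrite rev_path.
by rewrite -rev_rcons -lastI rev_uniq.
Qed.

(** * From an algorithm to a colouring of windows *)

Section ColourOfAlgorithm.

Variables (g : nat -> nat) (c : nat) (r : nat -> nat) (A : algorithm).
Hypotheses (c_gt0 : 0 < c) (solA : solves_orad g c r A).
Variable m : nat.
Let n := m.+3.
Let L := (g 2).+1.
Hypothesis lt_Ln : L.+1 < n.

(* The directions are those of the edges between positions [r n + i] and
   [r n + i + 1]. *)
Lemma no_constant_directions w b :
  size w = ((r n).*2 + L).+1 -> uniq w -> {subset w <= iota 0 n} ->
  ~ (forall i, i <= L -> out (view A n (nth 0 w) (r n) i) 0 = b).
Proof.
move=> sz_w uniq_w sub_w const_b.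
(* Complete the window to an assignment of identifiers to the whole cycle. *)
pose s := w ++ [seq x <- iota 0 n | x \notin w].
have s_perm : perm_eq s (iota 0 n).
  apply: uniq_perm; rewrite ?iota_uniq //.
    rewrite cat_uniq uniq_w filter_uniq ?iota_uniq // andbT andTb.
    by apply/hasPn=> x; rewrite mem_filter => /andP[].
  move=> x; rewrite mem_cat mem_filter.
  by case: (boolP (x \in w)) => //= /sub_w ->.
have le_wn : size w <= n by rewrite -(size_iota 0 n) uniq_leq_size.
have := solA (cycle_ident_bound s_perm c_gt0).
rewrite card_ord cycle_maxdeg -/n; set N := cycle_network s_perm.
set H := output A N (r n) => -[[_ orH] _].
have stepH i (u : 'I_n) : i <= L -> u = i + r n :> nat -> H u (ordS u) = b.
  move=> le_iL val_u; rewrite /H /output (@cycle_run A m s s_perm _ i) //; last first.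
    by apply: leq_trans le_wn; rewrite sz_w; lia.
  rewrite /= /cycle_adj !eqxx /= -(const_b i le_iL).
  congr (out _ _); apply: eq_view => k le_k.
  by rewrite nth_cat ifT // sz_w; lia.
have lt_rLn : L.+1 + r n < n.
  (* Without rounds the window has [L + 1] entries but the path has [L + 2] vertices, so the room
     comes from [lt_Ln]. *)
  case: (posnP (r n)) => [->|r_gt0]; first by rewrite addn0.
  by apply: leq_trans le_wn; rewrite sz_w; lia.
pose v i : 'I_n := inord (i + r n).
have val_v i : i <= L.+1 -> v i = i + r n :> nat.
  by move=> le_i; rewrite /v inordK //; apply: leq_ltn_trans lt_rLn; lia.
have vS i : i <= L -> ordS (v i) = v i.+1.
  move=> le_i; apply: val_inj; rewrite /= !val_v //; last lia.
  by rewrite modn_small //; apply: leq_ltn_trans lt_rLn; lia.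
pose p := [seq v i | i <- iota 1 L.+1].
have uniq_p : uniq (v 0 :: p).
  rewrite -[v 0 :: p]/[seq v i | i <- iota 0 L.+2] map_inj_in_uniq ?iota_uniq //.
  move=> i j; rewrite !mem_iota /= !add0n !ltnS => le_i le_j /(congr1 (@nat_of_ord n)).
  by rewrite !val_v // => /addIn.
have path_p (e : rel 'I_n) : (forall i, i <= L -> e (v i) (v i.+1)) -> path e (v 0) p.
  move=> He; apply/(pathP (v 0)) => i; rewrite size_map size_iota ltnS => le_i.
  rewrite (nth_map 0) ?size_iota // nth_iota // add1n.
  case: i le_i => [|i] le_i /=; first exact: He.
  by rewrite (nth_map 0) ?size_iota ?nth_iota ?add2n; [exact: He| lia..].
suff le_p : size p <= Defs.rad H.
  by move/(leq_trans le_p); rewrite size_map size_iota /L ltnNge leqnSn.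
case: b const_b stepH => const_b stepH.
  by apply: rad_ge uniq_p; apply: path_p => i le_i; rewrite -vS // (stepH i) ?val_v; lia.
(* No forward arc is present, so every edge is oriented backward and the reversed path is
   directed. *)
apply: rad_ge_rev uniq_p; apply: path_p => i le_i.
have := orH (v i) (v i.+1); rewrite -vS // (stepH i) ?val_v //; last lia.
by apply; rewrite /= /cycle_adj eqxx.
Qed.

(** If two windows shifted by one had equal colours, each of [L + 1] consecutive edges would point
    like the one before, so all would agree. *)
Lemma window_colouring :
  shift_colouring n ((r n).*2 + g 2) (window_colour A n (r n) L).
Proof.
move=> x w y sz_w srt lt_yn; apply/eqP=> eq_col.
pose e i := out (view A n (nth 0 (x :: rcons w y)) (r n) i) 0.
have eq_e i : i < L -> e i = e i.+1.
  move=> lt_iL; have := congr1 (fun t : L.-tuple bool => tnth t (Ordinal lt_iL)) eq_col.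
  rewrite !tnth_mktuple /=; congr (_ = _).
    congr (out _ _); apply: eq_view => k le_k.
    by rewrite -rcons_cons nth_rcons /= ifT //; lia.
  by congr (out _ _); apply: eq_view.
apply: (@no_constant_directions (x :: rcons w y) (e 0)).
- by rewrite /= size_rcons sz_w /L; lia.
- exact: sorted_uniq ltn_trans ltnn _ srt.
- move=> z; rewrite mem_iota /= add0n -rcons_cons mem_rcons inE => /orP[/eqP->//|z_in].
  move: srt; rewrite -rcons_cons -cats1 sorted_pairwise; last exact: ltn_trans.
  rewrite pairwise_cat allrel1r => /and3P[/allP/(_ z z_in) lt_zy _ _].
  exact: ltn_trans lt_zy lt_yn.
- by elim=> // i IHi lt_iL; rewrite -[LHS]/(e i.+1) -eq_e //; apply: IHi (ltnW lt_iL).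
Qed.

Lemma rounds_lower_bound : n <= tower ((r n).*2 + (g 2).*2 + 2) 1.
Proof.
have := shift_colouring_card window_colouring.
rewrite card_tuple card_bool -iterSr => le_n; apply: leq_trans le_n _.
(* The [2 ^ L] colours cost one level, and [L] more levels absorb the base, as [L < tower L 1]. *)
rewrite (_ : _ + 2 = ((r n).*2 + g 2).+1 + L); last by rewrite /L; lia.
by rewrite iterD leq_tower // ltnW // ltn_tower1.
Qed.

End ColourOfAlgorithm.

Theorem theorem31 (g : nat -> nat) (c : nat) (hc : 0 < c) :
  ~ exists (A : algorithm) (r : nat -> nat),
      little_o r logstar /\ solves_orad g c r A.
Proof.
move=> [A [r [o_r solA]]].
have [N leN] := o_r (1 / 4%:R)%R isT.
(* From [4 * r n <= M], the height [2 r n + 2 g 2 + 2] is at most [M / 2 + 2 g 2 + 2], which is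
   below [M] once [M > 4 g 2 + 4]; the summand [N] ensures [N <= n]. *)
pose M := N + 4 * g 2 + 5; pose n := tower M 1.
have lt_Mn : M < n by apply: ltn_tower1.
have r_le : 4 * r n <= M.
  apply: leq_trans (logstar_tower M).
  have leNn : N <= n by lia.
  by have := leN n leNn; rewrite -(ler_nat rat) natrM; lra.
have n_eq : n = (n - 3).+3 by lia.
have lt_gn : (g 2).+2 < n by lia.
have := @rounds_lower_bound g c r A hc solA (n - 3); rewrite -n_eq => /(_ lt_gn).
by apply/negP; rewrite -ltnNge; apply: tower1_ltn; lia.
Qed.
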